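(* Let $\lambda$ be a Borel probability measure on $[0,1]$. Let $\mathcal P^1$ and $\mathcal P^2$ be two sequences of partitions that are log-balanced in measure with respect to $\lambda$, with weight functions in measure $f_1$ and $f_2$, respectively, such that all the following hold: (i) $\mathcal P^2$ is self-refining; (ii) $f_2$ is nondecreasing; (iii) $f_2(n+1)-f_2(n)=o(f_2(n))$ as $n\to\infty$. Then $$\lim_{n\to\infty}\frac{f_2(L_n(x,\mathcal P^1,\mathcal P^2))}{f_1(n)}=1\quad\text{in measure }(\lambda).$$
   Context: $\mathbb N$ includes $0$. A topological partition of $[0,1]$ is a collection of pairwise disjoint nonempty open intervals the union of whose closures is $[0,1]$. A sequence of partitions $\mathcal P=\{P_n\}_{n\in\mathbb N}$ is a sequence of topological partitions of $[0,1]$; $E=E^{\mathcal P}$ is the set of all endpoints of intervals in all the $P_n$; for $x\in[0,1]\setminus E$, $I_n(x)$ is the unique interval of $P_n$ containing $x$. $\mathcal P$ is self-refining if, for each $n\in\mathbb N$, each interval of $P_{n+1}$ is contained in (possibly equal to) an interval of $P_n$. $\mathcal P$ is log-balanced in measure with respect to a Borel probability measure $\lambda$ on $[0,1]$ if $\lambda(E)=0$ and there is $f:\mathbb N\to\mathbb R$ with $f(n)\to+\infty$ such that $\frac{-\log\lambda(I_n(x))}{f(n)}\to1$ in $\lambda$-measure as $n\to\infty$; any such $f$ is called a weight function in measure of $\mathcal P$ with respect to $\lambda$. For sequences of partitions $\mathcal P^1,\mathcal P^2$ with endpoint sets $E^1,E^2$ and intervals $I_n^1(x),I_n^2(x)$,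 the Lochs index is $L_n(x,\mathcal P^1,\mathcal P^2)=\sup\{\ell\in\mathbb N : I_n^1(x)\subseteq I_\ell^2(x)\}$ (supremum in $\mathbb N\cup\{\infty\}$) for $x\in[0,1]\setminus(E^1\cup E^2)$. When both sequences are log-balanced in measure with respect to $\lambda$, it is finite for $\lambda$-a.e. $x$, so $f_2(L_n(x,\mathcal P^1,\mathcal P^2))$ is defined for a.e. $x$. *)

(* Defs.v *)
From HB Require Import structures.
From mathcomp Require Import all_boot all_order all_algebra.
From mathcomp Require Import all_classical all_reals all_analysis.
Import Order.TTheory GRing.Theory Num.Theory.
Import numFieldNormedType.Exports.

Set Implicit Arguments.
Unset Strict Implicit.
Unset Printing Implicit Defensive.

Local Open Scope classical_set_scope.
Local Open Scope ring_scope.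

Definition unit_interval {R : realType} : set R := `[0, 1]%classic.

Definition nonempty_open_interval {R : realType} (I : set R) : Prop :=
  exists a b : R, a < b /\ I = `]a, b[%classic.

(* The union of the closures is exactly [0, 1]; this is not a condition on the
   closure of the union. *)
Definition topological_partition {R : realType} (Q : set (set R)) : Prop :=
  [/\ forall I, Q I -> nonempty_open_interval I,
      trivIset Q id &
      \bigcup_(I in Q) closure I = unit_interval].

Definition sequence_of_partitions {R : realType} (P : nat -> set (set R)) :
    Prop :=
  forall n, topological_partition (P n).

Definition endpoints {R : realType} (P : nat -> set (set R)) : set R :=
  [set x | exists n (a b : R),
     [/\ a < b, P n `]a, b[%classic & x = a \/ x = b]].

(* The interval of [P n] containing [x]. It is unique for [x] in [0, 1] outside
   the endpoints; the value is [set0] when no interval contains [x]. *)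
Definition interval_at {R : realType} (P : nat -> set (set R)) (n : nat)
    (x : R) : set R :=
  xget set0 [set I | P n I /\ I x].

Definition self_refining {R : realType} (P : nat -> set (set R)) : Prop :=
  forall n J, P n.+1 J -> exists2 I, P n I & J `<=` I.

(* Convergence in measure of extended-real functions defined on [D] to a real
   constant. A point where [g n] is infinite counts as a deviation. *)
Definition cvg_in_measure {d} {T : measurableType d} {R : realType}
    (mu : set T -> \bar R) (D : set T) (g : nat -> T -> \bar R) (l : R) : Prop :=
  forall eps : R, 0 < eps ->
    (fun n => mu [set x | D x /\ (eps%:E < `|g n x - l%:E|)%E]) @ \oo
      --> (0 : \bar R).

(* [P] is log-balanced in measure with respect to [lambda], and [f] is a weight
   function in measure. *)
Definition weight_in_measure {R : realType}
    (lambda : probability (measurableTypeR R) R)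
    (P : nat -> set (set R)) (f : nat -> R) : Prop :=
  [/\ lambda (endpoints P) = 0%E,
      f @ \oo --> +oo &
      cvg_in_measure lambda (unit_interval `\` endpoints P)
        (fun n x => (- lne (lambda (interval_at P n x)) * ((f n)^-1)%:E)%E) 1].

Definition log_balanced_in_measure {R : realType}
    (lambda : probability (measurableTypeR R) R)
    (P : nat -> set (set R)) : Prop :=
  exists f, weight_in_measure lambda P f.

(* Supremum in N extended with infinity, encoded as [None]; the supremum of the
   empty set is 0. *)
Definition sup_enat (A : set nat) : option nat :=
  if `[< has_ubound A >] then Some (supremum 0%N A) else None.

Definition lochs_index {R : realType} (P1 P2 : nat -> set (set R)) (n : nat)
    (x : R) : option nat :=
  sup_enat [set l | interval_at P1 n x `<=` interval_at P2 l x].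

(* Weight functions tend to infinity, so they are extended by +oo at infinity. *)
Definition weight_at {R : realType} (f : nat -> R) (l : option nat) : \bar R :=
  if l is Some k then (f k)%:E else +oo%E.

(* Main.v *)
(* Fix [eps] and [d = eps / 4]. Outside a set of small measure,
   [- ln (lambda I_n^1(x))] is within a factor [1 +- d] of [f1 n], and similarly
   for [P2] at the levels [k] and [m] where [f2] first passes [(1 + eps) f1 n]
   and [(1 - eps) f1 n].
   Upper bound: if [L_n(x) >= k], self-refinement gives [I_n^1(x)] inside
   [I_k^2(x)], whose typical measure is smaller, a contradiction.
   Lower bound: if [L_n(x) < m], then [I_n^1(x)] contains an end of [I_m^2(x)].
   Each interval [J] of [P2 m] with [lambda J >= e] has at most two such
   intervals of [P1 n], of measure at most [q], so these points of [J] have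
   measure at most [2 q <= (2 q / e) * lambda J]; summing over [J] gives at most
   [2 q / e]. The growth condition on [f2] bounds [f2 m] by
   [(1 + eps / 2) (1 - eps) f1 n], so [q / e] decays exponentially in [f1 n]. *)
Require Import Defs.
From HB Require Import structures.
From mathcomp Require Import all_boot all_order all_algebra.
From mathcomp Require Import all_classical all_reals all_analysis.
From mathcomp Require Import measurable_realfun lra.
Import Order.TTheory GRing.Theory Num.Theory.
Import numFieldNormedType.Exports.
Local Open Scope classical_set_scope.
Local Open Scope ring_scope.

(** * Topological partitions and the interval around a point *)

Lemma partition_open {R : realType} (Q : set (set R)) (I : set R) :
  topological_partition Q -> Q I -> open I.
Proof. by case=> + _ _ => /[apply] -[a [b [_ ->]]]; exact: interval_open. Qed.

Lemma partition_eq {R : realType} (Q : set (set R)) (I J : set R) (x : R) :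
  topological_partition Q -> Q I -> Q J -> I x -> J x -> I = J.
Proof. by case=> _ tQ _ QI QJ Ix Jx; apply: tQ => //; exists x. Qed.

Lemma partition_sub01 {R : realType} (Q : set (set R)) :
  topological_partition Q -> \bigcup_(I in Q) I `<=` unit_interval.
Proof. by case=> _ _ <- x [I QI Ix]; exists I => //; exact: subset_closure. Qed.

Lemma interval_at_eq {R : realType} (P : nat -> set (set R)) n (I : set R) x :
  topological_partition (P n) -> P n I -> I x -> interval_at P n x = I.
Proof.
move=> tP PI Ix; apply: xget_unique => // J [PJ Jx].
exact: partition_eq tP PJ PI Jx Ix.
Qed.

(** An open interval of [P n] around an end of an interval of [P n] would overlap the latter, hence
    equal it, yet an open interval misses its ends. So a point covered at every level is no
    endpoint. The right side is a countable intersection of open sets, whence measurability. *)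
Lemma off_endpointsE {R : realType} (P : nat -> set (set R)) :
  sequence_of_partitions P ->
  unit_interval `\` endpoints P = \bigcap_n \bigcup_(I in P n) I.
Proof.
move=> sP; apply/seteqP; split=> [x [x01 xE] n _|x xP].
  have [itvP _ covP] := sP n.
  move: x01; rewrite -covP => -[I PI].
  have [a [b [ab IE]]] := itvP I PI; rewrite IE => /itv_closure.
  rewrite /= in_itv /= => /andP[ax xb].
  exists I => //; rewrite IE /= in_itv /= !lt_neqAle ax xb !andbT.
  apply/andP; split; apply/eqP => xe; apply: xE; exists n, a, b.
    by split; rewrite -?IE -?xe //; left.
  by split; rewrite -?IE ?xe //; right.
split; first by apply: (partition_sub01 _ (sP 0%N)); exact: xP.
move=> [n [a [b [ab PI xab]]]]; have [J PJ Jx] := xP n I.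
have Jo : open J by apply: partition_open (sP n) PJ.
have Jx_ : nbhs x J by exact: open_nbhs_nbhs.
have [y Jy yab] : exists2 y, J y & `]a, b[%classic y.
  case: xab => xE; rewrite xE in Jx_.
    apply/exists2P/(@filter_ex _ a^'+); near=> y; split.
      by near: y; rewrite near_withinE; apply: filterS Jx_.
    by rewrite /= in_itv /=; apply/andP; split.
  apply/exists2P/(@filter_ex _ b^'-); near=> y; split.
    by near: y; rewrite near_withinE; apply: filterS Jx_.
  by rewrite /= in_itv /=; apply/andP; split.
have JE : J = `]a, b[%classic by apply: partition_eq (sP n) PJ PI Jy yab.
by move: Jx; rewrite JE /= in_itv /=; case: xab => ->; rewrite ltxx ?andbF.
Unshelve. all: by end_near. Qed.

Lemma interval_atP {R : realType} (P : nat -> set (set R)) n x :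
  sequence_of_partitions P -> (unit_interval `\` endpoints P) x ->
  P n (interval_at P n x) /\ interval_at P n x x.
Proof.
move=> sP; rewrite off_endpointsE // => /(_ n I) [I PI Ix].
by rewrite (interval_at_eq P n I x (sP n)).
Qed.

(** Whatever [Q] is, the set is the off-endpoint set cut by a union of open intervals of [P n]. The
    exceptional sets below owe their measurability to this. *)
Lemma measurable_interval_at {R : realType} (P : nat -> set (set R)) n
    (Q : set R -> Prop) : sequence_of_partitions P ->
  measurable ([set x | (unit_interval `\` endpoints P) x /\
    Q (interval_at P n x)] : set (measurableTypeR R)).
Proof.
move=> sP.
have -> : [set x | (unit_interval `\` endpoints P) x /\
    Q (interval_at P n x)] = (unit_interval `\` endpoints P) `&`
    \bigcup_(I in [set I | P n I /\ Q I]) I.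
  apply/seteqP; split=> x [Dx].
    by move=> QI; split=> //; exists (interval_at P n x);
      have [] := interval_atP P n x sP Dx.
  by move=> [I [PI QI] Ix]; split=> //; rewrite (interval_at_eq P n I x (sP n)).
have om m (A : set (set R)) : A `<=` P m ->
    measurable (\bigcup_(I in A) I : set (measurableTypeR R)).
  move=> AP; apply: open_measurable; apply: bigcup_open => I /AP.
  exact: partition_open.
apply: measurableI; last by apply: (om n) => I [].
rewrite off_endpointsE //; apply: bigcap_measurable => [|k _].
  by exists 0%N.
exact: (om k).
Qed.

(** * Measure of the straddling points *)

(** Disjoint nonempty open subsets of the line are countably many, so [B] splits into countably many
    pieces and the local estimates add up. *)
Lemma measure_le_disjoint_open {R : realType}
    (mu : {measure set (measurableTypeR R) -> \bar R}) (Q : set (set R))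
    (B : set R) (K : R) :
  (forall I, Q I -> open I /\ I !=set0) -> trivIset Q id ->
  measurable (B : set (measurableTypeR R)) -> B `<=` \bigcup_(I in Q) I ->
  (forall I, Q I -> mu (B `&` I) <= K%:E * mu I)%E ->
  (mu B <= K%:E * mu (\bigcup_(I in Q) I))%E.
Proof.
move=> oQ tQ mB BQ le_K.
have /countable_injP[i injI] : countable Q.
  (* The family must be open and nonempty at every index, so it takes the dummy value [setT] outside
     [Q]. *)
  apply: (@separated_open_countable _ _
    (fun I => if `[< Q I >] then I else setT)) => [I|I|].
  - by case: asboolP => [/oQ[]|_] //; exact: openT.
  - by case: asboolP => [/oQ[]|_] //; exists 0.
  - move=> I J QI QJ; rewrite !asboolT //; exact: tQ.
(* [F k] is the member of [Q] with code [k], or empty if there is none; this turns [Q] into a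
   sequence. *)
pose F k := \bigcup_(I in [set I | Q I /\ i I = k]) I.
have FE I : Q I -> F (i I) = I.
  move=> QI; apply/seteqP; split=> [x [J [QJ iJ] Jx]|x Ix]; last by exists I.
  by rewrite -(injI J I) // inE.
have F0 k : (exists2 I, Q I & i I = k) \/ F k = set0.
  have [|nQ] := pselect (exists2 I, Q I & i I = k); first by left.
  by right; apply/seteqP; split=> // x [I [QI iI] _]; apply: nQ; exists I.
have mF k : measurable (F k : set (measurableTypeR R)).
  apply: open_measurable; apply: bigcup_open => I [QI _]; exact: (oQ I QI).1.
have tF : trivIset setT F.
  move=> k l _ _ [x [[I [QI iI] Ix] [J [QJ iJ] Jx]]].
  by rewrite -iI -iJ (tQ I J QI QJ) //; exists x.
have QF : \bigcup_(I in Q) I = \bigcup_k F k.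
  apply/seteqP; split=> x.
    by move=> [I QI Ix]; exists (i I) => //; exists I.
  by move=> [k _ [I [QI _] Ix]]; exists I.
have BF : B = \bigcup_k (B `&` F k).
  by rewrite -setI_bigcupr -QF; apply/esym/setIidl.
rewrite {1}BF QF !measure_bigcup //; last 2 first.
- by move=> k _; exact: measurableI.
- exact: trivIset_setIl.
rewrite -nneseriesZl //; apply: lee_nneseries => // k _.
have [[I QI <-]|->] := F0 k; first by rewrite FE //; exact: le_K.
by rewrite setI0 !measure0 mule0.
Qed.

Lemma measurable_partition {R : realType} (Q : set (set R)) (I : set R) :
  topological_partition Q -> Q I -> measurable (I : set (measurableTypeR R)).
Proof. by move=> tQ QI; apply: open_measurable; exact: partition_open tQ QI. Qed.

Lemma measurable_off_endpoints {R : realType} (P : nat -> set (set R)) :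
  sequence_of_partitions P ->
  measurable (unit_interval `\` endpoints P : set (measurableTypeR R)).
Proof.
move=> sP; have := measurable_interval_at P 0 (fun=> True) sP.
by congr measurable; apply/seteqP; split=> x // [].
Qed.

Lemma measure_straddling_le {R : realType}
    (lambda : probability (measurableTypeR R) R) (P1 P2 : nat -> set (set R))
    (n l : nat) (B : set R) (q e : R) :
  sequence_of_partitions P1 -> sequence_of_partitions P2 ->
  0 <= q -> 0 < e -> measurable (B : set (measurableTypeR R)) ->
  (forall x, B x -> exists I J : set R,
    [/\ P1 n I, P2 l J, I x, J x & ~ (I `<=` J) /\
      (lambda I <= q%:E)%E /\ (e%:E <= lambda J)%E]) ->
  (lambda B <= (2 * q / e)%:E)%E.
Proof.
move=> sP1 sP2 q0 e0 mB BP.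
have mJ J : P2 l J -> measurable (J : set (measurableTypeR R)).
  exact: measurable_partition (sP2 l).
have K0 : 0 <= 2 * q / e by rewrite divr_ge0 ?mulr_ge0 // ltW.
have mI y : measurable (interval_at P1 n y : set (measurableTypeR R)).
  rewrite /interval_at; case: xgetP => [I _ [PI _]|_]; last exact: measurable0.
  exact: measurable_partition (sP1 n) PI.
(* Here [y] need not be in [B]: it will be an end of some [J]. Any point of [B] in the interval
   around [y] identifies that interval with the light [I] given by [BP]. *)
have one y : (lambda (B `&` interval_at P1 n y) <= q%:E)%E.
  have [->|/set0P[x [Bx Iyx]]] := eqVneq (B `&` interval_at P1 n y) set0.
    by rewrite measure0 lee_fin.
  have [I [J [PI _ Ix _ [_ [Iq _]]]]] := BP x Bx.
  have PIy : P1 n (interval_at P1 n y).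
    by move: Iyx; rewrite /interval_at; case: xgetP => // I' _ [].
  rewrite (partition_eq _ _ _ _ (sP1 n) PIy PI Iyx Ix).
  apply: le_trans Iq; apply: le_measure; rewrite ?inE //.
    by apply: measurableI => //; exact: measurable_partition (sP1 n) PI.
  exact: measurable_partition (sP1 n) PI.
have U1 : (lambda (\bigcup_(J in P2 l) J) <= 1)%E.
  apply: probability_le1; apply: open_measurable; apply: bigcup_open => J.
  exact: partition_open (sP2 l).
apply: (@le_trans _ _ ((2 * q / e)%:E * lambda (\bigcup_(J in P2 l) J))%E);
    last first.
  by rewrite -[leRHS]mule1; apply: lee_wpmul2l => //; rewrite lee_fin.
have [itvP2 tP2 _] := sP2 l.
apply: measure_le_disjoint_open => //.
- move=> J PJ; split; first exact: partition_open (sP2 l) PJ.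
  have [a [b [ab ->]]] := itvP2 J PJ.
  by exists ((a + b) / 2); rewrite /= in_itv /= !midf_lt.
- by move=> x /BP [I [J [_ PJ _ Jx _]]]; exists J.
move=> J PJ.
have [->|/set0P[x [Bx Jx]]] := eqVneq (B `&` J) set0.
  by rewrite measure0 mule_ge0 // lee_fin.
have eJ : (e%:E <= lambda J)%E.
  have [I [J' [_ PJ' _ J'x [_ [_ eJ']]]]] := BP x Bx.
  by rewrite (partition_eq _ _ _ _ (sP2 l) PJ PJ' Jx J'x).
apply: (@le_trans _ _ (q%:E + q%:E)%E); last first.
  have -> : (q%:E + q%:E = (2 * q / e)%:E * e%:E)%E.
    by rewrite -EFinD -EFinM divfK ?gt_eqF // mulr2n mulrDl mul1r.
  by apply: lee_wpmul2l => //; rewrite lee_fin.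
have [a [b [ab JE]]] := itvP2 J PJ.
(* An end of [J] may lie in no interval of [P1 n]; its [interval_at] is then empty and contributes
   nothing. *)
have sub : B `&` J `<=`
    (B `&` interval_at P1 n a) `|` (B `&` interval_at P1 n b).
  move=> y [By Jy]; have [I [J' [PI PJ' Iy J'y [nIJ _]]]] := BP y By.
  rewrite -(partition_eq _ _ _ _ (sP2 l) PJ PJ' Jy J'y) JE in nIJ.
  have [c [d [cd IE]]] := (let: And3 h _ _ := sP1 n in h) I PI.
  have [Ia|nIa] := pselect (I a).
    by left; split; rewrite ?(interval_at_eq _ _ _ _ (sP1 n) PI Ia).
  have [Ib|nIb] := pselect (I b).
    by right; split; rewrite ?(interval_at_eq _ _ _ _ (sP1 n) PI Ib).
  (* An interval that meets [J] and contains neither end of [J] lies inside [J]. *)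
  exfalso; apply: nIJ => z.
  move: nIa nIb Iy Jy; rewrite IE JE /= !in_itv /= => /negP + /negP.
  rewrite !negb_and -!leNgt => na nb /andP[cy yd] /andP[ay yb] /andP[cz zd].
  apply/andP; split; first by case/orP: na => h; lra.
  by case/orP: nb => h; lra.
apply: (le_trans (le_measure lambda _ _ sub)); rewrite ?inE.
- by apply: measurableI => //; exact: mJ.
- by apply: measurableU; apply: measurableI.
apply: (le_trans (measureU2 _ _ _)); try exact: measurableI.
apply: (leeD (one a) (one b)).
Qed.

(** * Logarithmic bounds and suprema of levels *)

(** When [p] is not positive, [lne p] is [-oo] and the deviation is infinite, which the last
    hypothesis excludes; otherwise the bounds follow by exponentiation. *)
Lemma lne_ratio_bounds {R : realType} (p : \bar R) (f d : R) :
  0 < f -> p \is a fin_num ->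
  ~ (d%:E < `|- lne p * (f^-1)%:E - 1%:E|)%E ->
  ((expR (- ((1 + d) * f)))%:E <= p <= (expR (- ((1 - d) * f)))%:E)%E.
Proof.
case: p => [r| |] // f0 _.
rewrite /lne; case: ifPn => r0.
  by rewrite /= gt0_mulye ?lte_fin ?invr_gt0 //= ltry.
rewrite -EFinN -EFinM -EFinB /= lte_fin !lee_fin => /negP.
rewrite -leNgt ler_distl ler_pdivlMr // ler_pdivrMr // => /andP[lo hi].
rewrite -ltNge in r0.
by rewrite -[X in _ <= X <= _](lnK r0) !ler_expR; apply/andP; split; lra.
Qed.

Lemma interval_at_decreasing {R : realType} (P : nat -> set (set R)) x k l :
  sequence_of_partitions P -> self_refining P ->
  (unit_interval `\` endpoints P) x -> (k <= l)%N ->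
  interval_at P l x `<=` interval_at P k x.
Proof.
move=> sP rP Dx; elim: l => [|l IHl]; first by rewrite leqn0 => /eqP->.
rewrite leq_eqVlt => /orP[/eqP->//|/IHl]; apply: subset_trans.
have [PJ Jx] := interval_atP P l.+1 x sP Dx.
have [I PI JI] := rP _ _ PJ.
by rewrite (interval_at_eq _ _ _ _ (sP l) PI (JI _ Jx)).
Qed.

Lemma sup_enat_ge (A : set nat) k l : sup_enat A = Some k -> A l -> (l <= k)%N.
Proof.
rewrite /sup_enat; case: asboolP => // ubA [<-] Al.
exact: (ge_supremum_Nmem _ (nat_supremums_neq0 ubA)).
Qed.

(** Positivity of [l] covers the empty set, whose supremum is 0. *)
Lemma sup_enat_lt (A : set nat) l : (0 < l)%N ->
  (forall k, A k -> (k < l)%N) -> exists2 k, sup_enat A = Some k & (k < l)%N.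
Proof.
move=> l0 Al; rewrite /sup_enat.
have ubA : ubound A l.-1 by move=> k /Al kl; rewrite leEnat -ltnS prednK.
rewrite asboolT; last by exists l.-1.
exists (supremum 0%N A) => //.
have [->|A0] := eqVneq A set0; first by rewrite supremum0.
rewrite -[leqRHS](prednK l0) ltnS.
rewrite /supremum (negbTE A0); case: xgetP => [k _ [_ /(_ _ ubA)]|nA] //.
Qed.

Lemma weight_at_sup_ge {R : realType} (f : nat -> R) (A : set nat) l :
  nondecreasing_seq f -> A l -> ((f l)%:E <= weight_at f (sup_enat A))%E.
Proof.
move=> fnd Al; case E : (sup_enat A) => [k|] /=; last by rewrite leey.
by rewrite lee_fin fnd // (sup_enat_ge A).
Qed.

(** * First passage levels of a weight function *)

(** Take for [l n] the least level where [f] reaches [g n]. For each [N], eventually [f N < g n],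
    and monotonicity of [f] then keeps [l n] from falling below [N]. *)
Lemma first_passage {R : realType} (f g : nat -> R) :
  nondecreasing_seq f -> f @ \oo --> +oo -> g @ \oo --> +oo ->
  exists l : nat -> nat, [/\ l @ \oo --> \oo, forall n, g n <= f (l n) &
    forall n k, (k < l n)%N -> f k < g n].
Proof.
move=> fnd foo goo.
have ex n : exists k, g n <= f k.
  have /cvgryPge /(_ (g n)) := foo.
  by move=> /filter_ex [k]; exists k.
exists (fun n => ex_minn (ex n)); split.
- apply/cvgnyPge => N; have /cvgryPgt /(_ (f N)) := goo.
  apply: filterS => n fN; case: ex_minnP => m gm _.
  rewrite leqNgt; apply/negP => /ltnW /fnd mN.
  by have := le_lt_trans (le_trans gm mN) fN; rewrite ltxx.
- by move=> n; case: ex_minnP.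
move=> n k; case: ex_minnP => m _ mmin km; rewrite ltNge; apply/negP => /mmin.
by rewrite leqNgt km.
Qed.

(** One step before passage [f] is still below [g n], and the growth condition lets a single late
    step multiply [f] by at most [1 + eta]. *)
Lemma first_passage_overshoot {R : realType} (f g : nat -> R) (l : nat -> nat)
    (eta : R) : 0 < eta ->
  f @ \oo --> +oo -> (fun n => f n.+1 - f n) =o_\oo f -> l @ \oo --> \oo ->
  (forall n k, (k < l n)%N -> f k < g n) ->
  \forall n \near \oo, f (l n) <= (1 + eta) * g n.
Proof.
move=> eta0 foo /eqoP/(_ eta eta0) fo loo lg.
have f0 : \forall n \near \oo, 0 <= f n by exact: cvgry_ge.
have [N _ HN] : \forall n \near \oo, f n.+1 <= (1 + eta) * f n.
  near=> n; have : `|f n.+1 - f n| <= eta * `|f n| by near: n.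
  have fn0 : 0 <= f n by near: n.
  by rewrite (ger0_norm fn0) => /(le_trans (ler_norm _)); lra.
have := loo; move/cvgnyPge => /(_ N.+1); apply: filterS => n Nl.
have l0 : (0 < l n)%N by apply: leq_ltn_trans Nl.
have := HN (l n).-1; rewrite /= prednK // -ltnS prednK // => /(_ Nl) h.
apply: (le_trans h); apply: ler_wpM2l; first lra.
by apply/ltW/lg; rewrite prednK.
Unshelve. all: by end_near. Qed.

(** * Exceptional sets *)

Definition weight_deviation {R : realType}
    (lambda : probability (measurableTypeR R) R) (P : nat -> set (set R))
    (f : nat -> R) (d : R) (n : nat) : set R :=
  [set x | (unit_interval `\` endpoints P) x /\
    (d%:E < `|- lne (lambda (interval_at P n x)) * ((f n)^-1)%:E - 1%:E|)%E].

(* The noninclusion of [I_n^1(x)] in [I_l^2(x)] is phrased through [I_n^1(x)]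
   alone, so that it is constant on the intervals of [P1 n]. *)
Definition straddling {R : realType}
    (lambda : probability (measurableTypeR R) R) (P1 P2 : nat -> set (set R))
    (n l : nat) (q e : R) : set R :=
  [set x | (unit_interval `\` endpoints P1) x /\
    (~ (exists2 J, P2 l J & interval_at P1 n x `<=` J) /\
     (lambda (interval_at P1 n x) <= q%:E)%E)] `&`
  [set x | (unit_interval `\` endpoints P2) x /\
    (e%:E <= lambda (interval_at P2 l x))%E].

Lemma measurable_weight_deviation {R : realType}
    (lambda : probability (measurableTypeR R) R) (P : nat -> set (set R))
    (f : nat -> R) (d : R) (n : nat) : sequence_of_partitions P ->
  measurable (weight_deviation lambda P f d n : set (measurableTypeR R)).
Proof.
exact: (measurable_interval_at P n (fun I =>
  (d%:E < `|- lne (lambda I) * ((f n)^-1)%:E - 1%:E|)%E)).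
Qed.

Lemma measurable_straddling {R : realType}
    (lambda : probability (measurableTypeR R) R) (P1 P2 : nat -> set (set R))
    (n l : nat) (q e : R) :
  sequence_of_partitions P1 -> sequence_of_partitions P2 ->
  measurable (straddling lambda P1 P2 n l q e : set (measurableTypeR R)).
Proof.
move=> sP1 sP2; apply: measurableI.
  exact: (measurable_interval_at P1 n (fun I =>
    ~ (exists2 J, P2 l J & I `<=` J) /\ (lambda I <= q%:E)%E)).
exact: (measurable_interval_at P2 l (fun I => (e%:E <= lambda I)%E)).
Qed.

Lemma straddling_le {R : realType}
    (lambda : probability (measurableTypeR R) R) (P1 P2 : nat -> set (set R))
    (n l : nat) (q e : R) :
  sequence_of_partitions P1 -> sequence_of_partitions P2 -> 0 <= q -> 0 < e ->
  (lambda (straddling lambda P1 P2 n l q e) <= (2 * q / e)%:E)%E.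
Proof.
move=> sP1 sP2 q0 e0; apply: (measure_straddling_le lambda P1 P2 n l) => //.
  exact: measurable_straddling.
move=> x [[D1x [nJ Iq]] [D2x eJ]].
have [PI Ix] := interval_atP P1 n x sP1 D1x.
have [PJ Jx] := interval_atP P2 l x sP2 D2x.
exists (interval_at P1 n x), (interval_at P2 l x); split=> //; split=> //.
by move=> IJ; apply: nJ; exists (interval_at P2 l x).
Qed.

Definition lochs_deviation {R : realType} (P1 P2 : nat -> set (set R))
    (f1 f2 : nat -> R) (d : R) (n : nat) : set R :=
  [set x | (unit_interval `\` (endpoints P1 `|` endpoints P2)) x /\
    (d%:E < `|weight_at f2 (lochs_index P1 P2 n x) * ((f1 n)^-1)%:E - 1%:E|)%E].

Lemma measurable_lochs_deviation {R : realType} (P1 P2 : nat -> set (set R))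
    (f1 f2 : nat -> R) (d : R) (n : nat) :
  sequence_of_partitions P1 -> sequence_of_partitions P2 ->
  measurable (lochs_deviation P1 P2 f1 f2 d n : set (measurableTypeR R)).
Proof.
move=> sP1 sP2.
(* [L] expresses the Lochs index through [I_n^1(x)] alone: an interval of [P2 l] that includes
   [I_n^1(x)] contains [x], so it is [I_l^2(x)]. *)
pose L (I : set R) := sup_enat [set l | exists2 J, P2 l J & I `<=` J].
have LE x : (unit_interval `\` (endpoints P1 `|` endpoints P2)) x ->
    lochs_index P1 P2 n x = L (interval_at P1 n x).
  move=> [x01 /not_orP[nE1 nE2]]; congr sup_enat; apply/seteqP; split=> l /=.
    have [PJ Jx] := interval_atP P2 l x sP2 (conj x01 nE2).
    by move=> IJ; exists (interval_at P2 l x).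
  have [PI Ix] := interval_atP P1 n x sP1 (conj x01 nE1).
  by move=> [J PJ IJ]; rewrite (interval_at_eq _ _ _ _ (sP2 l) PJ (IJ _ Ix)).
have -> : lochs_deviation P1 P2 f1 f2 d n =
    [set x | (unit_interval `\` endpoints P1) x /\
      (d%:E < `|weight_at f2 (L (interval_at P1 n x)) * ((f1 n)^-1)%:E
        - 1%:E|)%E] `&`
    (unit_interval `\` endpoints P2).
  apply/seteqP; split=> x.
    move=> [Dx]; rewrite LE //; case: Dx => x01 /not_orP[nE1 nE2].
    by split; split.
  move=> [[[x01 nE1] dx] [_ nE2]].
  have Dx : (unit_interval `\` (endpoints P1 `|` endpoints P2)) x.
    by split=> // -[].
  by split=> //; rewrite LE.
apply: measurableI; last exact: measurable_off_endpoints.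
exact: (measurable_interval_at P1 n (fun I =>
  (d%:E < `|weight_at f2 (L I) * ((f1 n)^-1)%:E - 1%:E|)%E)).
Qed.

(** Outside the four sets on the right, the measure bounds give the inclusion at level [m] and
    refute it at level [k]. The index is then at least [m] and below [k], so [f2] of it is within
    [eps * f1 n] of [f1 n]. *)
Lemma lochs_deviation_sub {R : realType}
    (lambda : probability (measurableTypeR R) R) (P1 P2 : nat -> set (set R))
    (f1 f2 : nat -> R) (eps : R) (n k m : nat) :
  sequence_of_partitions P1 -> sequence_of_partitions P2 -> self_refining P2 ->
  nondecreasing_seq f2 -> 0 < eps < 1 -> 0 < f1 n -> (0 < k)%N ->
  (1 + eps) * f1 n <= f2 k -> (forall i, (i < k)%N -> f2 i < (1 + eps) * f1 n) ->
  (1 - eps) * f1 n <= f2 m ->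
  let d := eps / 4 in
  lochs_deviation P1 P2 f1 f2 eps n `<=`
    (weight_deviation lambda P1 f1 d n `|` weight_deviation lambda P2 f2 d k) `|`
    (weight_deviation lambda P2 f2 d m `|`
     straddling lambda P1 P2 n m (expR (- ((1 - d) * f1 n)))
       (expR (- ((1 + d) * f2 m)))).
Proof.
move=> sP1 sP2 rP2 nd2 /andP[eps0 eps1] f10 k0 lek ltk lem d x.
move=> [[x01 /not_orP[nE1 nE2]] dev]; apply: contrapT.
move=> /not_orP[/not_orP[ndev1 ndevk] /not_orP[ndevm nstr]].
have D1x : (unit_interval `\` endpoints P1) x by [].
have D2x : (unit_interval `\` endpoints P2) x by [].
have [PI Ix] := interval_atP P1 n x sP1 D1x.
have f2k0 : 0 < f2 k by apply: lt_le_trans lek; rewrite mulr_gt0 //; lra.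
have f2m0 : 0 < f2 m by apply: lt_le_trans lem; rewrite mulr_gt0 //; lra.
have mint P l : sequence_of_partitions P ->
    (unit_interval `\` endpoints P) x ->
    measurable (interval_at P l x : set (measurableTypeR R)).
  move=> sP Dx; have [PJ _] := interval_atP P l x sP Dx.
  exact: measurable_partition (sP l) PJ.
have bounds P f l : sequence_of_partitions P ->
    (unit_interval `\` endpoints P) x -> 0 < f l ->
    ~ weight_deviation lambda P f d l x ->
    ((expR (- ((1 + d) * f l)))%:E <= lambda (interval_at P l x) <=
     (expR (- ((1 - d) * f l)))%:E)%E.
  move=> sP Dx fl0 ndev; apply: lne_ratio_bounds => //.
    by apply: fin_num_measure; exact: mint.
  by move=> dl; apply: ndev; split.
have /andP[lo1 hi1] := bounds P1 f1 n sP1 D1x f10 ndev1.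
have /andP[lok hik] := bounds P2 f2 k sP2 D2x f2k0 ndevk.
have /andP[lo2 hi2] := bounds P2 f2 m sP2 D2x f2m0 ndevm.
pose A := [set l | interval_at P1 n x `<=` interval_at P2 l x].
(* Otherwise [x] is straddling, with [hi1] and [lo2] supplying the two measure bounds. *)
have Am : A m.
  apply: contrapT => nAm; apply: nstr; split; split=> //; split=> //.
  move=> [J PJ IJ]; apply: nAm.
  by rewrite /A /= (interval_at_eq _ _ _ _ (sP2 m) PJ (IJ _ Ix)).
have nAk : ~ A k.
  move=> /(le_measure lambda) le12.
  have := le_trans (le_trans lo1 (le12 _ _)) hik; rewrite !inE.
  move=> /(_ (mint P1 n sP1 D1x) (mint P2 k sP2 D2x)).
  rewrite lee_fin ler_expR lerN2.
  have : (1 - d) * ((1 + eps) * f1 n) <= (1 - d) * f2 k.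
    by apply: ler_wpM2l => //; rewrite /d; lra.
  (* The factor is [(1 - d) * (1 + eps) - (1 + d)] for [d = eps / 4]. *)
  have : 0 < (eps / 2 - eps ^+ 2 / 4) * f1 n.
    by rewrite mulr_gt0 // expr2; nra.
  by rewrite /d; nra.
(* By self-refinement, an inclusion at any level from [k] on would give one at level [k]; this also
   makes the index finite. *)
have [i LE ik] : exists2 i, sup_enat A = Some i & (i < k)%N.
  apply: sup_enat_lt => // j Aj; rewrite ltnNge; apply/negP => kj; apply: nAk.
  apply: subset_trans Aj _; exact: interval_at_decreasing.
have fi := ltk i ik.
have := weight_at_sup_ge f2 A m nd2 Am; rewrite LE /= lee_fin => mi.
move: dev; rewrite /lochs_index -/A LE /weight_at -EFinM -EFinB /= lte_fin.
apply/negP; rewrite -leNgt ler_distl.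
by rewrite ler_pdivlMr // ler_pdivrMr //; apply/andP; split; lra.
Qed.

(** * Convergence in measure of the normalised Lochs index *)

Theorem theorem6p14 (R : realType)
    (lambda : probability (measurableTypeR R) R)
    (lambda01 : lambda unit_interval = 1%E)
    (P1 P2 : nat -> set (set R)) (f1 f2 : nat -> R)
    (P1part : sequence_of_partitions P1)
    (P2part : sequence_of_partitions P2)
    (P1bal : weight_in_measure lambda P1 f1)
    (P2bal : weight_in_measure lambda P2 f2)
    (P2ref : self_refining P2)
    (f2nd : nondecreasing_seq f2)
    (f2o : (fun n => f2 n.+1 - f2 n) =o_\oo f2) :
  cvg_in_measure lambda (unit_interval `\` (endpoints P1 `|` endpoints P2))
    (fun n x => (weight_at f2 (lochs_index P1 P2 n x) * ((f1 n)^-1)%:E)%E) 1.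
Proof.
have [_ f1oo dev1] := P1bal; have [_ f2oo dev2] := P2bal.
move=> eps0 eps0_gt0.
(* Shrinking the tolerance only enlarges the deviation set, and [eps < 1] makes [(1 - eps) * f1 n]
   tend to infinity. *)
pose eps := Num.min eps0 (1 / 2).
have eps_le : eps <= eps0 by rewrite ge_min lexx.
have eps01 : 0 < eps < 1.
  rewrite lt_min eps0_gt0 /= gt_min; apply/andP; split; first lra.
  by apply/orP; right; lra.
have [eps_gt0 eps_lt1] := andP eps01.
pose d := eps / 4; have d0 : 0 < d by rewrite /d; lra.
have scaled c : 0 < c -> (fun n => c * f1 n) @ \oo --> +oo.
  move=> c0; apply/cvgryPge => A; have /cvgryPge /(_ (A / c)) := f1oo.
  by apply: filterS => n; rewrite ler_pdivrMr // mulrC.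
have [k [koo lek ltk]] : exists k : nat -> nat, [/\ k @ \oo --> \oo,
    forall n, (1 + eps) * f1 n <= f2 (k n) &
    forall n i, (i < k n)%N -> f2 i < (1 + eps) * f1 n].
  by apply: first_passage => //; apply: scaled; lra.
have [m [moo lem ltm]] : exists m : nat -> nat, [/\ m @ \oo --> \oo,
    forall n, (1 - eps) * f1 n <= f2 (m n) &
    forall n i, (i < m n)%N -> f2 i < (1 - eps) * f1 n].
  by apply: first_passage => //; apply: scaled; lra.
have eps2 : 0 < eps / 2 by lra.
have over := first_passage_overshoot _ _ _ _ eps2 f2oo f2o moo ltm.
(* This sequence will dominate the bound [2 * q / e] on the straddling set. *)
have cvgB : (fun n => (2 * expR (- (eps ^+ 2 / 8 * f1 n)))%:E) @ \oo --> 0%E.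
  apply: cvg_EFin; first exact: nearW.
  rewrite -[X in _ --> X](mulr0 2); apply: cvgMr.
  apply: (cvg_comp _ _ _ (@cvgr_expR R)).
  by apply: scaled; rewrite divr_gt0 // exprn_gt0.
have cvgbound : (fun n => (lambda (weight_deviation lambda P1 f1 d n) +
    lambda (weight_deviation lambda P2 f2 d (k n)) +
    (lambda (weight_deviation lambda P2 f2 d (m n)) +
     (2 * expR (- (eps ^+ 2 / 8 * f1 n)))%:E))%E) @ \oo --> 0%E.
  rewrite -[X in _ --> X]adde0 -[X in _ --> (X + _)%E]adde0.
  rewrite -[X in _ --> (_ + X)%E]adde0.
  apply: cvgeD => //; apply: cvgeD => //.
  - exact: dev1.
  - exact: (cvg_comp _ _ koo (dev2 d d0)).
  - exact: (cvg_comp _ _ moo (dev2 d d0)).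
apply: (squeeze_cvge _ (cvg_cst _) cvgbound); near=> n.
rewrite measure_ge0 /=.
have f1n0 : 0 < f1 n by near: n; exact: cvgry_gt.
have kn0 : (0 < k n)%N by near: n; move/cvgnyPgt: koo; exact.
have mf2 : f2 (m n) <= (1 + eps / 2) * ((1 - eps) * f1 n) by near: n.
have sub := lochs_deviation_sub lambda P1 P2 f1 f2 eps n (k n) (m n) P1part
  P2part P2ref f2nd eps01 f1n0 kn0 (lek n) (ltk n) (lem n).
have mdev P f j := measurable_weight_deviation lambda P f d j.
have mstr := measurable_straddling lambda P1 P2 n (m n)
  (expR (- ((1 - d) * f1 n))) (expR (- ((1 + d) * f2 (m n)))) P1part P2part.
have sub0 : lochs_deviation P1 P2 f1 f2 eps0 n `<=`
    lochs_deviation P1 P2 f1 f2 eps n.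
  by move=> x [Dx dx]; split=> //; apply: le_lt_trans dx; rewrite lee_fin.
apply: le_trans (le_measure lambda _ _ (subset_trans sub0 sub)) _.
- by rewrite inE; exact: measurable_lochs_deviation.
- rewrite inE; apply: measurableU; apply: measurableU => //; exact: mdev.
apply: le_trans (measureU2 _ _ _) _.
- by apply: measurableU; exact: mdev.
- by apply: measurableU => //; exact: mdev.
apply: leeD; first by apply: measureU2; exact: mdev.
apply: le_trans (measureU2 _ _ _) _ => //; first exact: mdev.
rewrite leeD2l //; apply: le_trans (straddling_le lambda P1 P2 n (m n) _ _
  P1part P2part (expR_ge0 _) (expR_gt0 _)) _.
(* The exponent of [q / e] is [(1 + d) * f2 (m n) - (1 - d) * f1 n]. With the overshoot bound, the
   coefficient of [f1 n] is at most [(1 + eps / 4) * (1 + eps / 2) * (1 - eps) - (1 - eps / 4)],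
   which equals [- 5 / 8 * eps ^+ 2 - eps ^+ 3 / 8] and so is below [- eps ^+ 2 / 8]. *)
rewrite lee_fin -mulrA ler_pM2l // -expRN -expRD ler_expR opprK.
have : (1 + d) * f2 (m n) <= (1 + d) * ((1 + eps / 2) * ((1 - eps) * f1 n)).
  by apply: ler_wpM2l => //; rewrite /d; lra.
have : 0 <= eps ^+ 2 * f1 n by rewrite mulr_ge0 // ?sqr_ge0 // ltW.
have : 0 <= eps ^+ 3 * f1 n by rewrite mulr_ge0 // ?exprn_ge0 // ltW.
by rewrite /d !exprS expr0; nra.
Unshelve. all: by end_near. Qed.
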